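(* Let $(\xi_n)_{n\in\mathbb{N}}\subset L^0_+$ be a sequence of nonnegative random variables on a probability space $(\Omega,\mathscr{F},\mathbb{P})$ which satisfies the strong law of large numbers (SLLN) with constant $\mu\in[0,\infty]$. Let $\bar\xi_n:=\frac1n\sum_{l=1}^n\xi_l$ for $n\in\mathbb{N}$, and let $$C:=\mathrm{conv}\{\xi_n:n\in\mathbb{N}\},\qquad\bar C:=\mathrm{conv}\{\bar\xi_n:n\in\mathbb{N}\}.$$ Then the following statements are equivalent: (i) $\mu<\infty$. (ii) $\xi_1\in L^1$. (iii) The set $C$ is bounded in probability. (iv) The set $\bar C$ is bounded in probability. Moreover, the following statements are equivalent: (i) $\mu=\infty$. (ii) $\xi_1\notin L^1$. (iii) The set $C$ is hereditarily unbounded in probability. (iv) The set $\bar C$ is hereditarily unbounded in probability.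
   Context: $L^0=L^0(\Omega,\mathscr{F},\mathbb{P})$ is the space of equivalence classes (modulo $\mathbb{P}$-almost sure equality) of real-valued random variables, $L^0_+$ is the convex cone of all $X\in L^0$ with $\mathbb{P}(X\ge 0)=1$, and $L^1=L^1(\Omega,\mathscr{F},\mathbb{P})$. A sequence $(\xi_n)_{n\in\mathbb{N}}\subset L^0_+$ satisfies the SLLN if there is a constant $\mu\in[0,\infty]$ (possibly infinite) such that (1) $\mathbb{E}[\xi_n]=\mu$ for all $n\in\mathbb{N}$, and (2) $(\xi_n)_{n\in\mathbb{N}}$ is $\mathbb{P}$-almost surely Cesàro convergent to $\mu$, i.e. $\frac1n\sum_{l=1}^n\xi_l\to\mu$ $\mathbb{P}$-almost surely in $[0,\infty]$. A set $K\subset L^0$ is bounded in probability if for every $\epsilon>0$ there is $M>0$ with $\sup_{X\in K}\mathbb{P}(|X|>M)<\epsilon$. For $B\in\mathscr{F}$ write $K|_B:=\{X\mathbf{1}_B:X\in K\}$. The set $K$ is hereditarily unbounded in probability (on $\Omega$) if for every $B\in\mathscr{F}$ with $\mathbb{P}(B)>0$ the set $K|_B$ is not bounded in probability. $\mathrm{conv}$ denotes the convex hull (finite convex combinations). *)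

(* Defs.v *)
From HB Require Import structures.
From mathcomp Require Import all_boot all_order all_algebra.
From mathcomp Require Import all_classical all_reals all_analysis.
From mathcomp Require Import measurable_realfun.

Set Implicit Arguments.
Unset Strict Implicit.
Unset Printing Implicit Defensive.

Import Order.TTheory GRing.Theory Num.Theory.
Import numFieldNormedType.Exports.

Local Open Scope classical_set_scope.
Local Open Scope ring_scope.
Local Open Scope quotient_scope.

(* The library's quotient [{mfun_ mu, T >-> R}] of the measurable functions by
   mu-almost everywhere equality carries no algebraic structure; it is made an
   lmodType here, with the operations induced from representatives. *)
Section L0_lmodule.
Context {d : measure_display} {T : measurableType d} {R : realType}.
Variable mu : {measure set T -> \bar R}.

Local Notation L0 := {mfun_ mu, T >-> R}.
Implicit Types (f g : {mfun T >-> R}) (X Y Z : L0) (a b : R).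

Definition L0_zero : L0 := \pi_L0 (0 : {mfun T >-> R}).
Definition L0_opp X : L0 := \pi_L0 (- repr X).
Definition L0_add X Y : L0 := \pi_L0 (repr X + repr Y).
Definition L0_scale a X : L0 := \pi_L0 (a *: repr X).

Lemma L0_piP f g : f = g %[ae mu] <-> \pi_L0 f = \pi_L0 g.
Proof.
split=> [fg|/eqP]; last by rewrite eqmodE => /asboolP.
by apply/eqP; rewrite eqmodE; apply/asboolP.
Qed.

Lemma L0_reprK f : repr (\pi_L0 f) = f %[ae mu].
Proof. by apply/L0_piP; rewrite reprK. Qed.

Lemma L0_pi_opp f : L0_opp (\pi_L0 f) = \pi_L0 (- f).
Proof.
apply/L0_piP; have := L0_reprK f.
by apply: filterS => w fw _; rewrite !mfunN /= fw.
Qed.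

Lemma L0_pi_add f g : L0_add (\pi_L0 f) (\pi_L0 g) = \pi_L0 (f + g).
Proof.
apply/L0_piP; have := L0_reprK f; have := L0_reprK g.
by apply: filterS2 => w gw fw _; rewrite !mfunD /= gw // fw.
Qed.

Lemma L0_pi_scale a f : L0_scale a (\pi_L0 f) = \pi_L0 (a *: f).
Proof.
apply/L0_piP; have := L0_reprK f.
by apply: filterS => w fw _; apply: (congr1 ( *%R a)); exact: fw.
Qed.

Lemma L0_ind (Q : L0 -> Prop) : (forall f, Q (\pi_L0 f)) -> forall X, Q X.
Proof. by move=> Qpi X; rewrite -(reprK X). Qed.

Lemma L0_addA : associative L0_add.
Proof.
move=> X Y Z; elim/L0_ind: X => f; elim/L0_ind: Y => g; elim/L0_ind: Z => h.
by rewrite !L0_pi_add addrA.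
Qed.

Lemma L0_addC : commutative L0_add.
Proof.
move=> X Y; elim/L0_ind: X => f; elim/L0_ind: Y => g.
by rewrite !L0_pi_add addrC.
Qed.

Lemma L0_add0 : left_id L0_zero L0_add.
Proof. by move=> X; elim/L0_ind: X => f; rewrite L0_pi_add add0r. Qed.

Lemma L0_addN : left_inverse L0_zero L0_opp L0_add.
Proof. by move=> X; elim/L0_ind: X => f; rewrite L0_pi_opp L0_pi_add addNr. Qed.

HB.instance Definition _ :=
  GRing.isZmodule.Build L0 L0_addA L0_addC L0_add0 L0_addN.

Lemma L0_scaleA a b X : L0_scale a (L0_scale b X) = L0_scale (a * b) X.
Proof. by elim/L0_ind: X => f; rewrite !L0_pi_scale scalerA. Qed.

Lemma L0_scale1 : left_id 1 L0_scale.
Proof. by move=> X; elim/L0_ind: X => f; rewrite L0_pi_scale scale1r. Qed.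

Lemma L0_scaleDr : right_distributive L0_scale +%R.
Proof.
move=> a X Y; elim/L0_ind: X => f; elim/L0_ind: Y => g.
by rewrite [LHS](congr1 _ (L0_pi_add f g)) !L0_pi_scale scalerDr -L0_pi_add.
Qed.

Lemma L0_scaleDl X : {morph L0_scale^~ X : a b / a + b}.
Proof.
by elim/L0_ind: X => f a b; rewrite !L0_pi_scale scalerDl -L0_pi_add.
Qed.

HB.instance Definition _ := GRing.Zmodule_isLmodule.Build R L0
  L0_scaleA L0_scale1 L0_scaleDr L0_scaleDl.

End L0_lmodule.

Definition convex_hull (R : numDomainType) (E : lmodType R) (K : set E) :
    set E :=
  [set x | exists n (t : 'I_n -> R) (v : 'I_n -> E),
    [/\ forall i, 0 <= t i, \sum_i t i = 1, forall i, K (v i)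
      & x = \sum_i t i *: v i]].

(* Sequences are indexed from 0: [xi n] is the (n+1)-st term, so the n-th
   Cesaro mean averages the first n+1 terms and never divides by zero. *)
Definition cesaro_mean (R : numFieldType) (E : lmodType R) (xi : nat -> E)
    (n : nat) : E :=
  n.+1%:R^-1 *: \sum_(l < n.+1) xi l.

Section L0_notions.
Context {d : measure_display} {T : measurableType d} {R : realType}.
Variable P : probability T R.

Local Notation L0 := {mfun_ P, T >-> R}.

Definition L0_nonneg : set L0 := [set X | P [set w | 0 <= X w] = 1%E].

Definition SLLN (xi : nat -> L0) (mu : \bar R) : Prop :=
  [/\ (0 <= mu)%E,
      forall n, 'E_P[xi n]%E = mu
    & {ae P, forall w, ((cesaro_mean xi n : L0) w)%:E @[n --> \oo] --> mu}].

Definition bounded_in_probability (K : set L0) : Prop :=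
  forall e : R, 0 < e -> exists2 M : R, 0 < M &
    (ereal_sup [set P [set w | (M < `|X w|)%R] | X in K] < e%:E)%E.

Definition L0_restrict (B : set T) (mB : measurable B) (X : L0) : L0 :=
  \pi_L0 (repr X * indic_mfun B mB).

Definition hereditarily_unbounded_in_probability (K : set L0) : Prop :=
  forall (B : set T) (mB : measurable B), (0 < P B)%E ->
    ~ bounded_in_probability (L0_restrict mB @` K).

End L0_notions.

(* Main.v *)
(* If mu < oo, all xi_n lie in the L^1-ball of radius mu, which is convex, hence
   contains C and barC, and is bounded in probability by Markov's inequality.
   If mu = oo, the Cesaro means, which belong to both C and barC, tend to oo
   almost surely, so on any B with P(B) > 0 they exceed any given M on a part
   of B whose probability tends to P(B).  As a hereditarily unbounded set is
   unbounded (take B = Omega), this dichotomy gives all the implications. *)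
Require Import Defs.
From mathcomp Require Import all_boot all_order all_algebra.
From mathcomp Require Import all_classical all_reals all_analysis.
From mathcomp Require Import measurable_realfun.

Set Implicit Arguments.
Unset Strict Implicit.
Unset Printing Implicit Defensive.

Import Order.TTheory GRing.Theory Num.Theory.
Import numFieldNormedType.Exports.

Local Open Scope classical_set_scope.
Local Open Scope ring_scope.

(** * Elementary facts on convex hulls and on events *)

Lemma convex_hull_cesaro_mean (R : numFieldType) (E : lmodType R)
    (xi : nat -> E) n :
  convex_hull (range xi) (cesaro_mean xi n).
Proof.
exists n.+1, (fun=> n.+1%:R^-1), (fun i => xi i); split => //.
- by rewrite sumr_const card_ord -(mulr_natr n.+1%:R^-1) mulVf// pnatr_eq0.
- by rewrite /cesaro_mean scaler_sumr.
Qed.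

Lemma sub_convex_hull (R : numDomainType) (E : lmodType R) (K : set E) :
  K `<=` convex_hull K.
Proof.
move=> x Kx; exists 1%N, (fun=> 1), (fun=> x); split => //.
- by rewrite big_ord1.
- by rewrite big_ord1 scale1r.
Qed.

(** The exceptional points lie in a null set [N], so [A] is contained in the union of [B] and [N].
    This compares events of classes whose representatives are known only almost everywhere. *)
Lemma ae_le_measure d (T : measurableType d) (R : realType)
    (mu : {measure set T -> \bar R}) (A B : set T) :
  measurable A -> measurable B -> {ae mu, forall w, A w -> B w} ->
  (mu A <= mu B)%E.
Proof.
move=> mA mB [N [mN N0 ABN]].
apply: (@le_trans _ _ (mu (B `|` N))); last first.
  by rewrite -[leRHS]adde0 -N0; exact: measureU2.
rewrite le_measure ?inE//; first exact: measurableU.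
move=> w Aw; have [Bw|Bw] := pselect (B w); first by left.
by right; apply: ABN => /(_ Aw).
Qed.

Lemma measurable_gtr d (T : measurableType d) (R : realType) (f : T -> R)
    (M : R) :
  measurable_fun setT f -> measurable [set w | M < f w].
Proof.
by move=> mf; rewrite -[X in measurable X]setTI -preimage_itvoy; exact: mf.
Qed.

(** * The $L^1$ norm on classes, with values in $[0,\infty]$ *)

Section L0.
Context {d : measure_display} {T : measurableType d} {R : realType}.
Variable P : probability T R.
Local Notation L0 := {mfun_ P, T >-> R}.
Implicit Types (X Y : L0) (K : set L0).

Local Notation norm1 X := (\int[P]_w `|(X : L0) w|%:E)%E.

Lemma measurable_abs_L0 X :
  measurable_fun setT (fun w => `|X w|%:E : \bar R).
Proof. by apply/measurable_EFinP; apply: measurableT_comp. Qed.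

(** The representative of a class is an arbitrary choice, so the operations on classes can be
    computed pointwise only outside a null set. *)
Lemma repr_L0_add X Y : {ae P, forall w, (X + Y : L0) w = X w + Y w}.
Proof.
have := L0_reprK P (repr X + repr Y).
by apply: filterS => w /(_ I) E; rewrite [LHS]E mfunD.
Qed.

Lemma repr_L0_scale a X : {ae P, forall w, (a *: X : L0) w = a * X w}.
Proof. by have := L0_reprK P (a *: repr X); apply: filterS => w; exact. Qed.

Lemma repr_L0_0 : {ae P, forall w, (0 : L0) w = 0}.
Proof.
by have := L0_reprK P (0 : {mfun T >-> R}); apply: filterS => w; exact.
Qed.

Lemma repr_L0_restrict (B : set T) (mB : measurable B) X :
  {ae P, forall w, L0_restrict mB X w = X w * \1_B w}.
Proof.
have := L0_reprK P (repr X * indic_mfun B mB).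
by apply: filterS => w; exact.
Qed.

Lemma L0_norm1_0 : norm1 0 = 0%E.
Proof.
rewrite -[RHS](integral0 P setT); apply: ge0_ae_eq_integral => //.
- exact: measurable_abs_L0.
- by have := repr_L0_0; apply: filterS => w -> _; rewrite normr0.
Qed.

Lemma L0_norm1_add X Y : (norm1 (X + Y)%R <= norm1 X + norm1 Y)%E.
Proof.
rewrite -ge0_integralD//; try exact: measurable_abs_L0.
apply: ae_ge0_le_integral => //.
- exact: measurable_abs_L0.
- by move=> w _; rewrite adde_ge0.
- by apply: emeasurable_funD; exact: measurable_abs_L0.
- have := repr_L0_add X Y; apply: filterS => w -> _.
  by rewrite -EFinD lee_fin ler_normD.
Qed.

Lemma L0_norm1_scale a X : norm1 (a *: X) = (`|a|%:E * norm1 X)%E.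
Proof.
rewrite -ge0_integralZl//; last exact: measurable_abs_L0.
apply: ge0_ae_eq_integral => //.
- exact: measurable_abs_L0.
- by apply: measurable_funeM; exact: measurable_abs_L0.
- have := repr_L0_scale a X; apply: filterS => w -> _.
  by rewrite normrM EFinM.
Qed.

(** Balls are convex: the triangle inequality and homogeneity bound the norm of $\sum_i t_i v_i$ by
    $\sum_i t_i m = m$. *)
Lemma L0_norm1_convex_hull (m : R) K : (forall X, K X -> norm1 X <= m%:E)%E ->
  (forall X, convex_hull K X -> norm1 X <= m%:E)%E.
Proof.
move=> Km _ [n [t [v [t0 t1 Kv ->]]]].
apply: (@le_trans _ _ (\sum_i (t i * m)%:E)%E); last first.
  by rewrite sumEFin -mulr_suml t1 mul1r.
elim/big_ind2 : _ => [|x X y Y Xx Yy|i _].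
- by rewrite L0_norm1_0.
- exact: le_trans (L0_norm1_add X Y) (leeD Xx Yy).
- by rewrite L0_norm1_scale ger0_norm// EFinM lee_wpmul2l ?lee_fin//; exact: Km.
Qed.

Lemma L0_norm1_bounded_in_probability (m : R) K : (forall X, K X -> norm1 X <= m%:E)%E ->
  bounded_in_probability K.
Proof.
(* [M] is chosen so that [M * (e / 2)] equals [|m| + 1]: the summand 1 keeps [M] positive when [m]
   is 0, and the bound [e / 2] on each probability keeps the supremum strictly below [e]. *)
move=> Km e e0; pose M := (`|m| + 1) * 2 / e.
have m0 : 0 < `|m| + 1 by rewrite ltr_wpDl.
have M0 : 0 < M by rewrite divr_gt0// mulr_gt0.
exists M => //.
apply: (@le_lt_trans _ _ (e / 2)%:E); last first.
  by rewrite lte_fin ltr_pdivrMr// ltr_pMr// ltr1n.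
apply: ge_ereal_sup => _ [X KX <-].
rewrite -(@lee_pmul2l _ M%:E)// -EFinM.
have -> : M * (e / 2) = `|m| + 1.
  by rewrite /M mulrA divfK ?gt_eqF// mulfK.
(* Markov's inequality with the identity as test function controls the event $|X|\ge M$, which
   contains the event $|X|>M$. *)
have := @markov _ _ _ P (repr X) id M M0 (@measurable_id _ _ _)
  (fun r r0 => r0) (fun x y _ _ xy => xy).
rewrite expectation.unlock => MX; apply: le_trans (le_trans MX _).
  apply: lee_wpmul2l; first by rewrite lee_fin ltW.
  apply: le_measure; rewrite ?inE.
  - by apply: measurable_gtr; exact: measurableT_comp.
  - rewrite -[X in measurable X]setTI.
    by apply: emeasurable_fun_c_infty => //; exact: measurable_abs_L0.
  - by move=> w /= Mw; rewrite lee_fin ltW.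
apply: le_trans (Km _ KX) _.
by rewrite lee_fin (le_trans (ler_norm m))// lerDl.
Qed.

(** * Hereditary unboundedness in probability *)

Lemma hereditarily_unboundedN K :
  hereditarily_unbounded_in_probability K -> ~ bounded_in_probability K.
Proof.
move=> Ku Kb; apply: (Ku setT measurableT); first by rewrite probability_setT.
suff -> : L0_restrict measurableT @` K = K by [].
have E X : L0_restrict (measurableT : measurable [set: T]) X = X.
  rewrite -[RHS](reprK X); apply/L0_piP; apply: aeW => w _.
  by rewrite [LHS](_ : _ = X w * \1_[set: T] w)// indicT mulr1.
apply/seteqP; split => [_ [X KX <-]|X KX]; first by rewrite E.
by exists X => //; rewrite E.
Qed.

(** If the restrictions to [B] were bounded, the tolerance [P B / 2] would give a level [M]. The
    parts of [B] where the sequence stays above [M] from index [n] on increase almost surely to [B],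
    yet each has probability at most [P B / 2]. *)
Lemma cvgy_hereditarily_unbounded K (X : nat -> L0) :
  (forall n, K (X n)) ->
  {ae P, forall w, (X n w)%:E @[n --> \oo] --> +oo%E} ->
  hereditarily_unbounded_in_probability K.
Proof.
move=> KX Xoo B mB PB Kb.
pose e := fine (P B) / 2.
have fPB : P B = (fine (P B))%:E by rewrite fineK// fin_num_measure.
have f0 : 0 < fine (P B) by rewrite -lte_fin -fPB.
have [M M0 Me] := Kb e (divr_gt0 f0 (ltr0n _ 2)).
(* Intersecting over the whole tail makes [A] increasing, so that continuity from below applies. *)
pose A n := B `&` \bigcap_(k in [set k | (n <= k)%N]) [set w | M < X k w].
have mS k : measurable [set w | M < X k w].
  exact: measurable_gtr.
have mA n : measurable (A n).
  by apply: measurableI => //; apply: bigcap_measurable => //; exists n => /=.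
have ndA : nondecreasing_seq A.
  apply/nondecreasing_seqP => n; apply/subsetPset.
  by apply: setIS => w Aw k /= nk; apply: Aw => /=; exact: ltnW.
have PAe n : (P (A n) <= e%:E)%E.
  apply: ltW; apply: le_lt_trans Me.
  apply: (@le_trans _ _ (P [set w | M < `|L0_restrict mB (X n) w|])).
    apply: ae_le_measure => //.
      by apply: measurable_gtr; exact: measurableT_comp.
    have := repr_L0_restrict mB (X n); apply: filterS => w /= -> [Bw /(_ n)/=].
    rewrite indicE mem_set// mulr1 => /(_ (leqnn n))/lt_le_trans ->//.
    exact: ler_norm.
  by apply: ereal_sup_ubound; exists (L0_restrict mB (X n)) => //; exists (X n).
have mU : measurable (\bigcup_n A n) by exact: bigcup_measurable.
have PU : P B = P (\bigcup_n A n).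
  apply/eqP; rewrite eq_le; apply/andP; split; last first.
    by rewrite le_measure ?inE// => w [n _ []].
  (* Wherever the sequence diverges to infinity, it eventually stays above [M], so such a point of
     [B] lies in some [A n]. *)
  apply: ae_le_measure => //; move: Xoo; apply: filterS => w Xw Bw.
  have /cvgeyPgt/(_ M)[n _ nM] := Xw.
  by exists n => //; split => // k /= nk; rewrite -lte_fin; exact: nM.
have cvgA : P (A n) @[n --> \oo] --> P B.
  by rewrite PU; exact: (nondecreasing_cvg_mu mA mU ndA).
have : (P B <= e%:E)%E.
  rewrite -(cvg_lim (@ereal_hausdorff _) cvgA).
  apply: lime_le; first by apply/cvg_ex; exists (P B).
  by near=> n; exact: PAe.
by rewrite fPB lee_fin leNgt ltr_pdivrMr// ltr_pMr// ltr1n.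
Unshelve. all: by end_near.
Qed.

(** * Nonnegative classes, expectation and integrability *)

Lemma L0_nonneg_ae X : L0_nonneg X -> {ae P, forall w, 0 <= X w}.
Proof.
move=> X1; have mX : measurable [set w | 0 <= X w].
  rewrite -preimage_itvcy -[X in measurable X]setTI.
  exact: (measurable_funP X).
exists (~` [set w | 0 <= X w]); split => //; first exact: measurableC.
by rewrite probability_setC// X1 subee.
Qed.

(** The absolute value changes the integrand only on a null set; the common value may be
    infinite. *)
Lemma L0_norm1_nonneg X : L0_nonneg X -> norm1 X = 'E_P[X]%E.
Proof.
move=> /L0_nonneg_ae X0; rewrite expectation.unlock; apply: ae_eq_integral => //.
- exact: measurable_abs_L0.
- by apply/measurable_EFinP.
- by move: X0; apply: filterS => w Xw _; rewrite ger0_norm.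
Qed.

Lemma L0_Lfun1 X : (X : T -> R) \in Lfun P 1 <-> (norm1 X < +oo)%E.
Proof.
split=> [/Lfun1_integrable/integrableP[]//|Xoo].
by apply/Lfun1_integrable/integrableP; split => //; apply/measurable_EFinP.
Qed.

End L0.

Theorem proposition4p1 (d : measure_display) (T : measurableType d)
    (R : realType) (P : probability T R) (xi : nat -> {mfun_ P, T >-> R})
    (mu : \bar R) (xi_ge0 : forall n, L0_nonneg (xi n)) (xi_slln : SLLN xi mu) :
  let C := convex_hull (range xi) in
  let barC := convex_hull (range (cesaro_mean xi)) in
  [<-> (mu < +oo)%E;
       (xi 0%N : T -> R) \in Lfun P 1;
       bounded_in_probability C;
       bounded_in_probability barC]
  /\
  [<-> mu = +oo%E;
       (xi 0%N : T -> R) \notin Lfun P 1;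
       hereditarily_unbounded_in_probability C;
       hereditarily_unbounded_in_probability barC].
Proof.
move=> C barC; have [mu0 Exi xi_cvg] := xi_slln.
have norm_xi n : (\int[P]_w `|xi n w|%:E)%E = mu.
  by rewrite L0_norm1_nonneg.
have Lfun_mu : (xi 0%N : T -> R) \in Lfun P 1 <-> (mu < +oo)%E.
  by rewrite -(norm_xi 0%N); exact: L0_Lfun1.
have bounded_mu : (mu < +oo)%E ->
    bounded_in_probability C /\ bounded_in_probability barC.
  move=> muoo; have fmu : mu = (fine mu)%:E by rewrite fineK// ge0_fin_numE.
  have Cmu : forall X : {mfun_ P, T >-> R}, C X -> (\int[P]_w `|X w|%:E <= (fine mu)%:E)%E.
    by apply: L0_norm1_convex_hull => _ [n _ <-]; rewrite norm_xi -fmu.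
  split; apply: (@L0_norm1_bounded_in_probability _ _ _ _ (fine mu)) => //.
  (* The Cesàro means lie in [C], hence in the ball of radius [mu]; convexity of the ball then
     covers [barC]. *)
  apply: L0_norm1_convex_hull => _ [n _ <-].
  by apply: Cmu; exact: convex_hull_cesaro_mean.
have unbounded_mu : mu = +oo%E -> hereditarily_unbounded_in_probability C /\
    hereditarily_unbounded_in_probability barC.
  move=> muoo; rewrite muoo in xi_cvg.
  split; apply: (cvgy_hereditarily_unbounded _ xi_cvg) => n.
    exact: convex_hull_cesaro_mean.
  by apply: sub_convex_hull; exists n.
have mu_dich : ~ (mu < +oo)%E <-> mu = +oo%E.
  by split=> [/negP|->]; rewrite ?ltxx// -leNgt leye_eq => /eqP.
split; tfae.
- by move/Lfun_mu.
- by move/Lfun_mu/bounded_mu => [].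
(* The passage from [C] to [barC] goes through [mu]: an infinite [mu] would make [C] unbounded. *)
- move=> Cb; apply: (bounded_mu _).2; apply: contrapT => /mu_dich.
  move=> /unbounded_mu[Cu _].
  exact: hereditarily_unboundedN Cu Cb.
- move=> Cb; apply: contrapT => /mu_dich/unbounded_mu[_ Cu].
  exact: hereditarily_unboundedN Cu Cb.
- by move=> muoo; apply/negP => /Lfun_mu; rewrite muoo ltxx.
- by move=> /negP xiL; apply: (unbounded_mu _).1; apply/mu_dich => /Lfun_mu.
(* Unboundedness is not inherited by smaller sets, so here too the value of [mu] is recovered first:
   a finite one would make [C] bounded. *)
- move=> Cu; apply: (unbounded_mu _).2; apply/mu_dich => /bounded_mu[Cb _].
  exact: hereditarily_unboundedN Cu Cb.
- move=> Cu; apply/mu_dich => /bounded_mu[_ Cb].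
  exact: hereditarily_unboundedN Cu Cb.
Qed.
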